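(* There exists a real constant $C>0$ such that for every integer $m\ge 1$, $N_m\le C^m$.
   Context: For integers $1\le m\le n$ and a binary string $\mathbf{x}=x_1\dots x_n\in\{0,1\}^n$, let $P(m,\mathbf{x})$ denote the probability distribution on $\{0,1\}^m$ of the random string $x_{i_1}x_{i_2}\dots x_{i_m}$, where the indices $1\le i_1<\dots<i_m\le n$ are chosen uniformly at random among all $\binom{n}{m}$ such choices (i.e. a uniformly random $m$-element subset of positions is kept, with the order preserved). Let $R(m,n)$ denote the statement that the map $\mathbf{x}\mapsto P(m,\mathbf{x})$ on $\{0,1\}^n$ is one-to-one. Define $N_m:=\sup\{n : n\ge m,\ R(m,n)\text{ holds}\}$, the supremum being taken over integers $n$ and a priori valued in $\mathbb{N}\cup\{\infty\}$. *)

(* Defs.v *)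
From mathcomp Require Import all_boot all_order all_algebra.
From mathcomp Require Import all_classical all_reals ereal.
Set Implicit Arguments.
Unset Strict Implicit.
Unset Printing Implicit Defensive.
Import Order.TTheory GRing.Theory Num.Theory.
Local Open Scope ring_scope.
Local Open Scope classical_set_scope.

(* The index sequences i_1 < ... < i_m, positions being numbered from 0. *)
Definition index_choices (m n : nat) : {set m.-tuple 'I_n} :=
  [set i : m.-tuple 'I_n | sorted ltn (map val i)]%SET.

Definition substring (m n : nat) (x : n.-tuple bool) (i : m.-tuple 'I_n) :
  m.-tuple bool := [tuple tnth x (tnth i k) | k < m].

(* Probability mass function on {0,1}^m of the substring of x read at a
   uniformly random element of index_choices m n. *)
Definition P (m n : nat) (x : n.-tuple bool) : {ffun m.-tuple bool -> rat} :=
  [ffun y => #|[set i in index_choices m n | substring x i == y]%SET|%:R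
             / 'C(n, m)%:R].

Lemma card_index_choices (m n : nat) : #|index_choices m n| = 'C(n, m).
Proof. exact: card_ltn_sorted_tuples. Qed.

Lemma P_ge0 (m n : nat) (x : n.-tuple bool) (y : m.-tuple bool) : 0 <= P m x y.
Proof. by rewrite ffunE divr_ge0 ?ler0n. Qed.

Lemma sum_P (m n : nat) (x : n.-tuple bool) :
  (m <= n)%N -> \sum_(y : m.-tuple bool) P m x y = 1.
Proof.
move=> mn; under eq_bigr do rewrite ffunE.
rewrite -mulr_suml -natr_sum; set s := (\sum_ _ _)%N.
have -> : s = 'C(n, m).
  rewrite -card_index_choices -sum1_card /s.
  rewrite (partition_big (@substring m n x) xpredT) //=.
  by apply: eq_bigr => y _; rewrite -sum1_card; apply: eq_bigl => i; rewrite inE.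
by rewrite divff // pnatr_eq0 -lt0n bin_gt0.
Qed.

Definition reconstructible (m n : nat) : Prop :=
  injective (fun x : n.-tuple bool => P m x).

(* The supremum is taken in the extended reals, so it is +oo when the set of
   lengths n is unbounded. *)
Definition N (R : realType) (m : nat) : \bar R :=
  ereal_sup [set (n%:R)%:E | n in [set n | (m <= n)%N /\ reconstructible m n]].

(* Main.v *)
Require Import Defs.
From mathcomp Require Import all_boot all_order all_algebra.
From mathcomp Require Import all_classical all_reals ereal.
From mathcomp Require Import zify.
Import Order.TTheory GRing.Theory Num.Theory.
Local Open Scope ring_scope.

(** The bound is a pigeonhole argument.  For each of the [2 ^ m] strings [y] of
    length [m], the probability [P m x y] is determined by an occurrence count
    between 0 and ['C(n, m)].  Hence [P m] takes at most
    [('C(n, m) + 1) ^ (2 ^ m) <= (n + 1) ^ (m * 2 ^ m)] values on the [2 ^ n]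
    strings of length [n], and injectivity forces
    [2 ^ n <= (n + 1) ^ (m * 2 ^ m)] ([reconstructible_leq_exp]).  With [t] an
    integer such that [n + 1 <= 2 ^ t], comparing exponents gives
    [n <= t * (m * 2 ^ m) <= t * 4 ^ m] ([reconstructible_leq_log]).  The least
    such [t] is at most twice the square root of [n] ([sqr_succ_leq_exp2]), so
    [n ^ 2 <= 4 * n * 16 ^ m], that is, [n <= 4 * 16 ^ m <= 64 ^ m]. *)

Lemma card_occurrences_leq (m n : nat) (x : n.-tuple bool) (y : m.-tuple bool) :
  (#|[set i in index_choices m n | substring x i == y]%SET| <= 'C(n, m))%N.
Proof.
rewrite -card_index_choices; apply: subset_leq_card.
by apply/fintype.subsetP => i; rewrite inE => /andP[].
Qed.

(** The unnormalised form of [P m x].  The bound on the counts is built into the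
    codomain so that the possible values form a finite type to be counted. *)
Definition occurrences (m n : nat) (x : n.-tuple bool) :
    {ffun m.-tuple bool -> 'I_('C(n, m)).+1} :=
  [ffun y => Ordinal (card_occurrences_leq m n x y : (_ < 'C(n, m).+1)%N)].

Lemma occurrences_inj (m n : nat) :
  reconstructible m n -> injective (occurrences m n).
Proof.
move=> Pinj x x' /ffunP eq_occ; apply: Pinj; apply/ffunP => y.
by have := congr1 val (eq_occ y); rewrite !ffunE /= => ->.
Qed.

Lemma bin_leq_exp (n m : nat) : ('C(n, m) <= n ^ m)%N.
Proof.
apply: (@leq_trans (n ^_ m)); first by rewrite -bin_ffact leq_pmulr ?fact_gt0.
elim: m => [|m IHm]; first by rewrite ffactn0.
by rewrite ffactnSr expnSr leq_mul ?leq_subr.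
Qed.

Lemma succ_bin_leq_exp (n m : nat) : (0 < m)%N -> ('C(n, m) < n.+1 ^ m)%N.
Proof.
by move=> m_gt0; apply: leq_ltn_trans (bin_leq_exp n m) _; rewrite ltn_exp2r.
Qed.

Lemma reconstructible_leq_exp (m n : nat) : (0 < m)%N -> reconstructible m n ->
  (2 ^ n <= n.+1 ^ (m * 2 ^ m))%N.
Proof.
move=> m_gt0 /occurrences_inj/leq_card.
rewrite card_ffun !card_tuple card_bool card_ord => /leq_trans; apply.
by rewrite expnM leq_exp2r ?expn_gt0 // succ_bin_leq_exp.
Qed.

Lemma reconstructible_leq_log (m n t : nat) : (0 < m)%N -> (n < 2 ^ t)%N ->
  reconstructible m n -> (n <= t * 4 ^ m)%N.
Proof.
move=> m_gt0 n_lt /(reconstructible_leq_exp m n m_gt0) le_exp.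
have : (2 ^ n <= 2 ^ (t * (m * 2 ^ m)))%N.
  apply: leq_trans le_exp _.
  by rewrite [in leqRHS]expnM leq_exp2r // muln_gt0 m_gt0 expn_gt0.
rewrite leq_exp2l // => /leq_trans; apply.
by rewrite leq_mul2l (expnMn 2 2) leq_mul2r (ltnW (ltn_expl m _)) ?orbT.
Qed.

(** Any bound of the logarithm by a power of [n] with exponent below 1 would give
    an exponential bound on [n]; the exponent 1/2 is chosen because squaring
    both sides of [n <= t * 4 ^ m] keeps the computation in integers. *)
Lemma sqr_succ_leq_exp2 (t : nat) : (t.+1 ^ 2 <= 4 * 2 ^ t)%N.
Proof.
(* The induction step needs [(t + 2) ^ 2 <= 2 * (t + 1) ^ 2], which fails for
   [t <= 1]. *)
case: t => [|[|t]] //; elim: t => // t IHt.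
rewrite [in leqRHS]expnS; move: (2 ^ t.+2)%N IHt => p.
by rewrite -!mulnn; nia.
Qed.

Lemma reconstructible_leq_exp64 (m n : nat) : (0 < m)%N -> (0 < n)%N ->
  reconstructible m n -> (n <= 64 ^ m)%N.
Proof.
move=> m_gt0 n_gt0 rec_mn; set t := trunc_log 2 n.
have /andP[t_le t_gt] : (2 ^ t <= n < 2 ^ t.+1)%N by exact: trunc_log_bounds.
have n_le := reconstructible_leq_log m n t.+1 m_gt0 t_gt rec_mn.
have n_le16 : (n <= 4 * 16 ^ m)%N.
  (* Multiplied by [n], the goal reads [n ^ 2 <= 4 * n * 16 ^ m]. *)
  rewrite -(leq_pmul2l n_gt0); apply: leq_trans (leq_mul n_le n_le) _.
  rewrite mulnACA -expnMn mulnn mulnA leq_mul2r (leq_trans (sqr_succ_leq_exp2 t)) ?orbT //.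
  by rewrite mulnC leq_mul2r t_le.
apply: leq_trans n_le16 _; rewrite (expnMn 4 16) leq_mul2r.
by rewrite -[leqLHS](expn1 4) leq_exp2l // m_gt0 orbT.
Qed.

Theorem theorem4 (R : realType) :
  exists C : R, 0 < C /\ forall m : nat, (1 <= m)%N -> (N R m <= (C ^+ m)%:E)%E.
Proof.
exists 64%:R; split=> [|m m_gt0]; first by rewrite ltr0n.
apply: ge_ereal_sup => _ [n [le_mn rec_mn] <-].
rewrite lee_fin -natrX ler_nat.
exact: reconstructible_leq_exp64 (leq_trans m_gt0 le_mn) rec_mn.
Qed.
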